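(* Let $\Gamma_1,\Gamma_2,\Gamma_3$ be three circles in the Euclidean plane with centers $O_1,O_2,O_3$ and radii $r_1,r_2,r_3$ respectively. Then the points $M_{O_1}(\Gamma_2,\Gamma_3)$, $M_{O_2}(\Gamma_3,\Gamma_1)$ and $M_{O_3}(\Gamma_1,\Gamma_2)$ are collinear if and only if the following equation holds: $$\sum_{i=1}^3|O_iO_{i+1}|^2|O_iO_{i+2}|^2\,(r_{i+1}^2-r_{i+2}^2)=\sum_{i=1}^3 r_{i+1}^2r_{i+2}^2\,\bigl(|O_iO_{i+1}|^2-|O_iO_{i+2}|^2\bigr),$$ where $O_{i+3}=O_i$ and $r_{i+3}=r_i$ for $i=1,2,3$.
   Context: For a circle $\Gamma$ with center $O$ and radius $r$ in the Euclidean plane and a point $X$, the power of $X$ with respect to $\Gamma$ is $P_\Gamma(X)=|OX|^2-r^2$. For a point $A$ and two circles $\Gamma,\Gamma'$ in the plane, the geometric locus of the points $X$ satisfying $$\frac{P_{\Gamma}(X)}{P_{\Gamma'}(X)}=\frac{P_{\Gamma}(A)}{P_{\Gamma'}(A)}$$ is a circle (possibly degenerate), called the Apollonius circle of the point $A$ to the circles $\Gamma,\Gamma'$ and denoted $K_A(\Gamma,\Gamma')$. The center of this circle is denoted $M_A(\Gamma,\Gamma')$.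
   Formalization: The centers O_1, O_2, O_3 are assumed not collinear (otherwise ''only if'' fails, e.g. centers 0, 1, 3 on a line with radii 2, 3, 1); when an Apollonius circle degenerates to a line, its center is read as the point at infinity orthogonal to it. *)

(* Defs.v *)
From mathcomp Require Import all_boot all_order all_algebra.
From mathcomp Require Import boolp classical_sets reals.

Set Implicit Arguments.
Unset Strict Implicit.
Unset Printing Implicit Defensive.

Import Order.TTheory GRing.Theory Num.Theory.
Local Open Scope classical_set_scope.
Local Open Scope ring_scope.

Definition dot (R : realType) (u v : 'rV[R]_2) : R := (u *m v^T) 0 0.

(* The canonical norm on 'rV[R]_2 is the sup norm, hence this definition. *)
Definition dist (R : realType) (X Y : 'rV[R]_2) : R :=
  Num.sqrt (dot (X - Y) (X - Y)).

Record circle (R : realType) := Circle {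
  center : 'rV[R]_2;
  radius : R;
  radius_gt0 : 0 < radius
}.

Definition power (R : realType) (G : circle R) (X : 'rV[R]_2) : R :=
  dist (center G) X ^+ 2 - radius G ^+ 2.

(* The equality of ratios P_G(X) / P_G'(X) = P_G(A) / P_G'(A) is
   cross-multiplied: the common points of G and G', where the left-hand side
   is 0/0, lie on the Apollonius circle, and A may lie on G'. *)
Definition apollonius (R : realType) (A : 'rV[R]_2) (G G' : circle R) :
    set 'rV[R]_2 :=
  [set X | power G X * power G' A = power G A * power G' X].

(* The Euclidean plane completed by its points at infinity.  AtInfinity d is
   meaningful for d != 0 only, and d matters up to a nonzero factor. *)
Inductive extpoint (R : realType) :=
  | Proper of 'rV[R]_2
  | AtInfinity of 'rV[R]_2.

(* A degenerate circle is a single point (rho = 0) or a line; the center of a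
   line is the point at infinity in the direction orthogonal to it.  The whole
   plane, which is the value of apollonius A G G' when A lies on both G and G',
   has no center. *)
Definition is_center (R : realType) (M : extpoint R) (K : set 'rV[R]_2) : Prop :=
  match M with
  | Proper C => exists2 rho : R, 0 <= rho & K = [set X | dist C X = rho]
  | AtInfinity d => d != 0 /\ exists c : R, K = [set X | dot d X = c]
  end.

(* (n, c) != (0, 0) is the line n . X = c; for n = 0 it is the line at
   infinity. *)
Definition on_line (R : realType) (n : 'rV[R]_2) (c : R) (p : extpoint R) : Prop :=
  match p with
  | Proper X => dot n X = c
  | AtInfinity d => dot n d = 0
  end.

Definition collinear (R : realType) (p q r : extpoint R) : Prop :=
  exists (n : 'rV[R]_2) (c : R), (n, c) != (0, 0) /\
    [/\ on_line n c p, on_line n c q & on_line n c r].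

(* Main.v *)
(* In homogeneous coordinates the center of K_A(G, G'), proper or at infinity,
   is P_G'(A) [O : 1] - P_G(A) [O' : 1].  Three points of the extended plane are
   collinear iff the determinant of their homogeneous coordinates vanishes, and
   here, with P_ij = P_(Gamma_j)(O_i), this determinant is that of the triangle
   times P_13 P_21 P_32 - P_12 P_23 P_31, as in Menelaus' theorem.  In the
   expansion of the latter with P_ij = |O_i O_j|^2 - r_j^2, the products of three
   distances and those of three radii cancel, which leaves the stated equation. *)

Require Import Defs.
From mathcomp Require Import all_boot all_order all_algebra.
From mathcomp Require Import boolp classical_sets reals.
From mathcomp Require Import ring lra.

Set Implicit Arguments.
Unset Strict Implicit.
Unset Printing Implicit Defensive.

Import Order.TTheory GRing.Theory Num.Theory.
Local Open Scope ring_scope.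

(** * Cases and determinants for three indices *)

Lemma ord3P (P : 'I_3 -> Prop) : (forall i, P i) <-> [/\ P 0, P 1 & P 2].
Proof.
split=> [h|[h0 h1 h2] [[|[|[|//]]] i3]]; first by split; apply: h.
- by rewrite (_ : Ordinal i3 = 0) //; apply: val_inj.
- by rewrite (_ : Ordinal i3 = 1) //; apply: val_inj.
- by rewrite (_ : Ordinal i3 = 2) //; apply: val_inj.
Qed.

Lemma det_mx33 (R : comNzRingType) (B : 'M[R]_3) : \det B =
  B 0 0 * (B 1 1 * B 2 2 - B 1 2 * B 2 1)
  - B 0 1 * (B 1 0 * B 2 2 - B 1 2 * B 2 0)
  + B 0 2 * (B 1 0 * B 2 1 - B 1 1 * B 2 0).
Proof.
rewrite (expand_det_row _ 0) !big_ord_recl big_ord0 /cofactor.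
rewrite !(expand_det_row _ 0) !big_ord_recl !big_ord0 /cofactor !det_mx11 !mxE.
(* Indexing by [nat] turns ordinals with equal values but different proofs into the same term for
   [ring]. *)
pose b (i j : nat) := B (inord i) (inord j).
have bE i j : B i j = b i j by rewrite /b !inord_val.
by rewrite !bE /= /bump /=; ring.
Qed.

Section Plane.
Variable R : realType.
Implicit Types (u v A C d X : 'rV[R]_2) (G : circle R) (p : extpoint R).

(** * Orthogonality and distances in the plane *)

Definition perp u : 'rV[R]_2 := \row_j [:: - u 0 1; u 0 0]`_j.

Lemma row2P u v : u 0 0 = v 0 0 -> u 0 1 = v 0 1 -> u = v.
Proof.
move=> h0 h1; apply/rowP => j; case: (unliftP 0 j) => [k ->|-> //].
by rewrite ord1 (_ : lift 0 0 = 1) //; apply: val_inj.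
Qed.

Lemma dotE u v : dot u v = u 0 0 * v 0 0 + u 0 1 * v 0 1.
Proof.
rewrite /dot mxE big_ord_recl big_ord1 !mxE.
by rewrite (_ : lift 0 0 = 1) //; apply: val_inj.
Qed.

Lemma dot_eq0 u : dot u u = 0 -> u = 0.
Proof.
rewrite dotE -!expr2 => /eqP; rewrite paddr_eq0 ?sqr_ge0 // !sqrf_eq0.
by case/andP => /eqP h0 /eqP h1; apply: row2P; rewrite mxE.
Qed.

(** A nonzero [u] and its quarter turn [perp u] form an orthogonal basis. *)
Lemma dot_perp_eq0 u v : dot u v = 0 -> dot (perp u) v = 0 -> u != 0 -> v = 0.
Proof.
move=> h hp u0; have uu : dot u u != 0 by apply: contra_neq u0 => /dot_eq0.
have e : dot u u * dot v v = dot u v ^+ 2 + dot (perp u) v ^+ 2.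
  by rewrite !dotE !mxE /=; ring.
apply: dot_eq0; apply: (mulfI uu).
by rewrite e h hp expr0n /= addr0 mulr0.
Qed.

Lemma sqr_dist u v : dist u v ^+ 2 = dot (u - v) (u - v).
Proof.
by rewrite /dist sqr_sqrtr // dotE -!expr2 addr_ge0 // sqr_ge0.
Qed.

Lemma eq_dist u v rho : 0 <= rho ->
  dist u v = rho <-> dot (u - v) (u - v) = rho ^+ 2.
Proof.
move=> r0; rewrite -sqr_dist; split=> [-> //|/eqP].
by rewrite eqrXn2 // ?sqrtr_ge0 // => /eqP.
Qed.

(** Opposite points of the circle about [C] through [A] are equidistant from [C'], so their diameter
    is orthogonal to [C - C']; two perpendicular diameters suffice. *)
Lemma dist_center_inj A C C' :
  A != C ->
  (forall v, dot v v = dot (A - C) (A - C) ->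
     dot (C + v - C') (C + v - C') = dot (A - C') (A - C')) ->
  C = C'.
Proof.
set w := A - C => AC h.
have w0 : w != 0 by rewrite subr_eq0.
(* The circle contains the four vertices of a square of center [C]. *)
have h1 := h (- w); have h2 := h (perp w); have h3 := h (- perp w).
apply/eqP; rewrite -subr_eq0; apply/eqP.
have {}h1 : dot w (C - C') = 0.
  have := h1 _; rewrite /w !dotE !mxE /=.
  lra.
have {}h2 : dot (perp w) (C - C') = 0.
  have := h2 _; have := h3 _; rewrite /w !dotE !mxE /=.
  lra.
exact: dot_perp_eq0 h1 h2 w0.
Qed.

(** * Homogeneous coordinates of points and lines *)

Definition homog p : 'rV[R]_3 :=
  match p with
  | Proper X => row_mx X 1%:M
  | AtInfinity d => row_mx d 0
  end.

(** The minus sign turns incidence into the vanishing of the pairing with [homog]. *)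
Definition covec (n : 'rV[R]_2) (c : R) : 'rV[R]_3 := row_mx n (- c)%:M.

Lemma covec_eq0 n c : (covec n c == 0) = ((n, c) == (0, 0)).
Proof.
apply/eqP/eqP=> [|[-> ->]]; last by rewrite /covec oppr0 raddf0 (@row_mx0 _ 1 2 1).
rewrite -(row_mx0 _ 1 2 1) => /(@eq_row_mx _ _ 2 1)[-> /matrixP/(_ 0 0)].
by rewrite !mxE mulr1n => /eqP; rewrite oppr_eq0 => /eqP ->.
Qed.

Lemma covec_surj (v : 'rV[R]_3) : exists n c, v = covec n c.
Proof.
exists (@lsubmx _ 1 2 1 v), (- (@rsubmx _ 1 2 1 v) 0 0).
by rewrite /covec opprK -mx11_scalar (@hsubmxK _ 1 2 1).
Qed.

Lemma on_lineE n c p : on_line n c p <-> (covec n c *m (homog p)^T) 0 0 = 0.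
Proof.
have e d (b : 'M_1) :
    (covec n c *m (row_mx d b : 'rV_3)^T) 0 0 = dot n d - c * b 0 0.
  rewrite (@tr_row_mx _ 1 2 1) (@mul_row_col _ 1 2 1) mxE -/(dot _ _).
  by rewrite mul_scalar_mx !mxE mulNr.
case: p => X /=; rewrite e mxE ?mulr1 ?mulr0 ?subr0 //.
by split=> [->|/eqP]; rewrite ?subrr// subr_eq0 => /eqP.
Qed.

(** A common line is a nonzero [covec] in the left kernel of the transposed matrix. *)
Lemma collinear_det (p : 'I_3 -> extpoint R) :
  collinear (p 0) (p 1) (p 2) <-> \det (\matrix_i homog (p i)) = 0.
Proof.
set H := \matrix_i _.
have on_lines n c : covec n c *m H^T = 0 <->
    [/\ on_line n c (p 0), on_line n c (p 1) & on_line n c (p 2)].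
  have e i : (covec n c *m H^T) 0 i = (covec n c *m (homog (p i))^T) 0 0.
    by rewrite !mxE; apply: eq_bigr => j _; rewrite !mxE.
  rewrite -(ord3P (fun i => on_line n c (p i))); split=> h.
    by move=> i; apply/on_lineE; rewrite -e h mxE.
  by apply/rowP => i; rewrite e [RHS]mxE; apply/on_lineE.
rewrite -det_tr; split.
  case=> n [c [nc hl]]; apply/eqP/det0P.
  by exists (covec n c); [rewrite covec_eq0|apply/on_lines].
move/eqP/det0P => [v]; have [n [c ->]] := covec_surj v.
by rewrite covec_eq0 => nc /on_lines ?; exists n, c.
Qed.

(** * Centers of Apollonius circles *)

(* Subtracting the equation at [A], which lies on the Apollonius circle, leaves
   no constant term. *)
Lemma apollonius_shift A G G' u
    (s := power G' A - power G A)
    (N := power G' A *: center G - power G A *: center G') :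
  apollonius A G G' (A + u) <-> s * dot u u + 2 * dot u (s *: A - N) = 0.
Proof.
rewrite /apollonius /=.
have e : power G (A + u) * power G' A - power G A * power G' (A + u)
    = s * dot u u + 2 * dot u (s *: A - N).
  rewrite /s /N; set a := power G A; set a' := power G' A.
  have shift (K : circle R) :
      power K (A + u) = power K A + dot u u + 2 * dot u (A - center K).
    by rewrite /power !sqr_dist !dotE !mxE; ring.
  by rewrite !shift -/a -/a' !dotE !mxE; ring.
by rewrite -e; split=> [->|/eqP]; rewrite ?subrr// subr_eq0 => /eqP.
Qed.

Lemma neq0_perp v : exists2 u, u != 0 & dot u v = 0.
Proof.
have [->|v0] := eqVneq v 0.
  exists (\row_j 1); last by rewrite dotE !mxE !mulr0 addr0.
  by apply/eqP => /rowP/(_ 0)/eqP; rewrite !mxE oner_eq0.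
exists (perp v); last by rewrite dotE !mxE /=; ring.
apply: contra_neq v0 => h; apply: row2P; rewrite mxE.
  by move/rowP/(_ 1): h; rewrite !mxE.
by move/rowP/(_ 0): h; rewrite !mxE /= => /eqP; rewrite oppr_eq0 => /eqP.
Qed.

(** The equation describes the circle through [A] about [s^-1 *: N] if [s != 0], and the line
    through [A] with normal [N] if [s = 0] and [N != 0]. Comparison with the set prescribed by
    [is_center] rules out the mismatched cases. *)
Lemma homog_center_eqn A N s (K : set 'rV[R]_2) (M : extpoint R) :
  (forall u, K (A + u) <-> s * dot u u + 2 * dot u (s *: A - N) = 0) ->
  is_center M K ->
  exists2 k, k != 0 & homog M = k *: (row_mx N s%:M : 'rV_(2 + 1)).
Proof.
move=> hK; have KA : K A.
  by rewrite -[A]addr0; apply/hK; rewrite !dotE !mxE; ring.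
case: M => [C [rho rho0 KE]|d [d0 [c KE]]].
  move: KA; rewrite KE /= => /(eq_dist _ _ rho0) Arho.
  have {}hK u : s * dot u u + 2 * dot u (s *: A - N) = 0 <->
      dot (A + u - C) (A + u - C) = dot (A - C) (A - C).
    rewrite -hK KE /= (eq_dist _ _ rho0) -Arho.
    by rewrite (_ : dot (C - (A + u)) _ = dot (A + u - C) (A + u - C))
      1?(_ : dot (C - A) _ = dot (A - C) (A - C)) // !dotE !mxE; ring.
  have [s0|s0] := eqVneq s 0.
    (* For [s = 0] the set would contain the line through [A] along [u], but no circle contains a
       line. *)
    have [u u0 uN] := neq0_perp N.
    have h (b : R) : dot (A + b *: u - C) (A + b *: u - C) = dot (A - C) (A - C).
      apply/hK; rewrite -[RHS](mulr0 (- 2 * b)) -uN s0 !dotE !mxE; ring.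
    case/eqP: u0; apply: dot_eq0.
    by move: (h 1) (h (- 1)); rewrite !dotE !mxE; lra.
  exists s^-1; rewrite ?invr_eq0 // scale_row_mx scale_scalar_mx mulVf //.
  set C0 := s^-1 *: N; suff -> : C = C0 by [].
  have {}hK X : dot (X - C) (X - C) = dot (A - C) (A - C) <->
      dot (X - C0) (X - C0) = dot (A - C0) (A - C0).
    rewrite -[X](addrNK A) [X - A + A]addrC -hK.
    have -> : N = s *: C0 by rewrite scalerA mulfV // scale1r.
    set u := X - A.
    have -> : s * dot u u + 2 * dot u (s *: A - s *: C0) =
       s * (dot (A + u - C0) (A + u - C0) - dot (A - C0) (A - C0)).
      by rewrite !dotE !mxE; ring.
    split=> [/eqP|->]; last by rewrite subrr mulr0.
    by rewrite mulf_eq0 (negPf s0) subr_eq0 => /eqP.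
  (* The circles through [A] about [C] and about [C0] coincide. Uniqueness of the center applies to
     whichever has positive radius; if neither has, both centers are [A]. *)
  have [AC|AC] := eqVneq A C; last first.
    by apply: dist_center_inj AC _ => v hv; apply/hK; rewrite [C + v]addrC addrK.
  have [<-//|AC0] := eqVneq A C0.
  apply/esym; apply: dist_center_inj AC0 _ => v hv.
  by apply/hK; rewrite [C0 + v]addrC addrK.
have {}hK u : s * dot u u + 2 * dot u (s *: A - N) = 0 <-> dot d u = 0.
  move: KA; rewrite -hK KE /= => <-.
  by rewrite !dotE !mxE; split=> ?; lra.
have dd : dot d d != 0 by apply: contra_neq d0 => /dot_eq0.
(* [perp d] is the direction of the line [K]; the points [b = 1] and [b = -1] separate the quadratic
   term from the linear one. *)
have h (b : R) : s * dot (b *: perp d) (b *: perp d)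
    + 2 * dot (b *: perp d) (s *: A - N) = 0.
  by apply/hK; rewrite !dotE !mxE /=; ring.
have s0 : s = 0.
  apply: (mulIf dd); rewrite mul0r.
  by move: (h 1) (h (- 1)); rewrite !dotE !mxE /=; lra.
have pN : dot (perp d) N = 0.
  by move: (h 1); rewrite s0 !dotE !mxE /=; lra.
(* Otherwise [u := d] would solve the equation, forcing [dot d d = 0]. *)
have dN : dot d N != 0.
  apply: contra_neq dd => dN; apply/hK; move: dN.
  by rewrite s0 !dotE !mxE; lra.
have dE : dot d N *: d = dot d d *: N.
  move: pN; rewrite !dotE !mxE /= => pN.
  have e : d 0 1 * N 0 0 = d 0 0 * N 0 1 by lra.
  by apply: row2P; rewrite !mxE !mulrDl; [rewrite -!mulrA|]; ring: e.
exists (dot d d / dot d N); first by rewrite mulf_neq0 ?invr_eq0.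
rewrite s0 raddf0 scale_row_mx scaler0 /=.
by rewrite [_ / _]mulrC -scalerA -dE scalerA mulVf // scale1r.
Qed.

Lemma homog_center A G G' (M : extpoint R) :
  is_center M (apollonius A G G') ->
  exists2 k, k != 0 & homog M =
    k *: (power G' A *: homog (Proper (center G))
          - power G A *: homog (Proper (center G'))).
Proof.
move=> /(homog_center_eqn (apollonius_shift A G G'))[k k0 ->]; exists k => //.
move: (power G A) (power G' A) => a a'; congr (_ *: _).
apply/rowP => j; rewrite mxE [RHS]mxE [X in _ = X + _]mxE [X in _ = _ + X]mxE.
rewrite [X in _ = _ - X]mxE /= [X in _ * X + _]mxE [X in _ - _ * X]mxE.
case: split => l; first by rewrite 4!mxE.
by rewrite !ord1 !mxE eqxx !mulr1.
Qed.

End Plane.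

(* Indices live in 'I_3 = Z/3Z, so that i + 1 and i + 2 are cyclic. *)
Theorem theorem2p4 (R : realType) (Gamma : 'I_3 -> circle R)
    (O := fun i => center (Gamma i)) (r := fun i => radius (Gamma i))
    (O_triangle : ~ collinear (Proper (O 0)) (Proper (O 1)) (Proper (O 2)))
    (M : 'I_3 -> extpoint R)
    (M_center : forall i : 'I_3,
       is_center (M i) (apollonius (O i) (Gamma (i + 1)) (Gamma (i + 2)))) :
  collinear (M 0) (M 1) (M 2) <->
  \sum_(i < 3) dist (O i) (O (i + 1)) ^+ 2 * dist (O i) (O (i + 2)) ^+ 2
               * (r (i + 1) ^+ 2 - r (i + 2) ^+ 2)
  = \sum_(i < 3) r (i + 1) ^+ 2 * r (i + 2) ^+ 2
               * (dist (O i) (O (i + 1)) ^+ 2 - dist (O i) (O (i + 2)) ^+ 2).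
Proof.
have {M_center} Mk i := homog_center (M_center i).
pose P i j := power (Gamma j) (O i).
pose T : 'M_3 := \matrix_i homog (Proper (O i)).
(* Up to a factor, row [i] holds the barycentric coordinates of [M i] in the triangle of the
   [O j]. *)
pose B : 'M_3 := \matrix_(i, j)
  (P i (i + 2) *+ (j == i + 1) - P i (i + 1) *+ (j == i + 2)).
have /choice[k kM] i : exists k, k != 0 /\ homog (M i) = k *: (row i B *m T).
  have [k k0 ->] := Mk i; exists k; split=> //; congr (_ *: _).
  rewrite -/(P i (i + 1)) -/(P i (i + 2)).
  have rowT j : homog (Proper (center (Gamma j))) = delta_mx 0 j *m T.
    by rewrite -rowE rowK.
  rewrite !rowT !scalemxAl -mulmxBl; congr (_ *m T).
  by apply/rowP => j; rewrite !mxE eqxx /= !mulr_natr.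
have detM : \det (\matrix_i homog (M i)) = (\prod_i k i) * (\det B * \det T).
  transitivity (\det (diag_mx (\row_i k i) *m (B *m T))).
    congr (\det _); apply/row_matrixP => i; rewrite rowK (kM i).2 -row_mul.
    by rewrite mul_diag_mx; apply/rowP => j; rewrite !mxE.
  by rewrite !det_mulmx det_diag; congr (_ * _); apply: eq_bigr => i; rewrite mxE.
have T0 : \det T != 0.
  by apply/eqP => /(collinear_det (fun i => Proper (O i))).
have k0 : \prod_i k i != 0 by apply/prodf_neq0 => i _; exact: (kM i).1.
have -> : collinear (M 0) (M 1) (M 2) <-> \det B = 0.
  rewrite collinear_det detM; split=> [/eqP|->]; last by rewrite mul0r mulr0.
  by rewrite !mulf_eq0 (negPf k0) (negPf T0) orbF /= => /eqP.
have e12 : 1 + 2 = 0 :> 'I_3 by apply: val_inj.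
have e21 : 2 + 1 = 0 :> 'I_3 by apply: val_inj.
have e22 : 2 + 2 = 1 :> 'I_3 by apply: val_inj.
have e11 : 1 + 1 = 2 :> 'I_3 by [].
have sum3 (F : 'I_3 -> R) : \sum_(i < 3) F i = F 0 + F 1 + F 2.
  rewrite !big_ord_recl big_ord0 addr0 addrA.
  by congr (_ + F _ + F _); apply: val_inj.
have distC X Y : dist X Y ^+ 2 = dist Y X ^+ 2 :> R.
  by rewrite !sqr_dist !dotE !mxE; ring.
have PE i j : P i j = dist (O i) (O j) ^+ 2 - r j ^+ 2.
  by rewrite distC.
(* As [B] has zero diagonal, its determinant is [P 0 2 * P 1 0 * P 2 1 - P 0 1 * P 1 2 * P 2 0]. *)
rewrite !sum3 det_mx33 !mxE !add0r !e12 !e21 !e22 !e11 /= !mulr1n !mulr0n !PE.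
rewrite (distC (O 1) (O 0)) (distC (O 2) (O 0)) (distC (O 2) (O 1)).
by split=> h; lra.
Qed.
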